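(* Let $A,B\in\mathbb{C}^{N\times N}$, let $\omega>0$, $\Delta t>0$ with $\sin(\omega\Delta t)\ne0$, and let $$\alpha=\frac{(\omega\Delta t)^2}{2-2\cos(\omega\Delta t)}=\frac{(\omega\Delta t)^2}{4\sin(\frac{\omega\Delta t}{2})^2},\qquad \beta=\frac{\omega\Delta t}{\sin(\omega\Delta t)} .$$ Let $U,F\in\mathbb{C}^N$ and set $u_n=e^{i\omega n\Delta t}U$, $f_n=e^{i\omega n\Delta t}F$ for $n\in\mathbb{Z}$. Then $$(-\omega^2I+i\omega B+A)U=F$$ if and only if $u_n,f_n$ satisfy $$\frac{1}{\Delta t^2}(u_{n+1}-2u_n+u_{n-1})+\frac{1}{2\Delta t}\tilde B(u_{n+1}-u_{n-1})+\tilde A u_n=\alpha^{-1}f_n\qquad(n\in\mathbb{Z}),$$ where $\tilde A=\alpha^{-1}A$ and $\tilde B=\alpha^{-1}\beta B$. *)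

(* Defs.v *)
From mathcomp Require Export all_boot all_order all_algebra.
From mathcomp Require Export complex.
From mathcomp Require Export reals sequences exp trigo.

Set Implicit Arguments.
Unset Strict Implicit.
Unset Printing Implicit Defensive.

Import Order.TTheory GRing.Theory Num.Theory.
Local Open Scope ring_scope.
Local Open Scope complex_scope.

(* MathComp-Analysis only has the real exponential, so the complex one is
   given through e^(a + i b) = e^a (cos b + i sin b). *)
Definition expC (R : realType) (z : R[i]) : R[i] :=
  (expR (complex.Re z))%:C * (cos (complex.Im z) +i* sin (complex.Im z)).

Definition time_harmonic (R : realType) (N : nat) (omega dt : R)
    (V : 'cV[R[i]]_N) (n : int) : 'cV[R[i]]_N :=
  expC (0 +i* (omega * n%:~R * dt)) *: V.

(* Main.v *)
(** Sampling at step [dt] turns the shift [n -> n+1] into multiplication by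
    [e^(i omega dt)], so the centered second and first differences act on a
    time-harmonic sequence as the scalars [2 cos (omega dt) - 2] and
    [2 i sin (omega dt)].  The factors [alpha] and [beta] are chosen so that,
    after division by [dt^2] and [2 dt], these become [- omega^2 / alpha] and
    [i omega / beta].  Hence the discrete equation at time [n] is the Helmholtz
    equation multiplied by the nonzero scalar [e^(i omega n dt) / alpha]; the
    converse only needs [n = 0]. *)
Require Import Defs.
From mathcomp Require Import ring lra.
Import Order.TTheory GRing.Theory Num.Theory.
Local Open Scope ring_scope.
Local Open Scope complex_scope.

Lemma expC_imag (R : realType) (x : R) : expC (0 +i* x) = cos x +i* sin x.
Proof. by rewrite /expC /= expR0 mul1r. Qed.

Lemma cos_half_angle (R : realType) (x : R) :
  2 - 2 * cos x = 4 * sin (x / 2) ^+ 2.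
Proof.
have {1}-> : x = (x / 2) *+ 2 by rewrite -mulr_natr divfK ?pnatr_eq0.
by rewrite cos_mulr2n cos2sin2; ring.
Qed.

(** If the difference vanished, then [cos x = 1] and the Pythagorean identity would force
    [sin x = 0]. This keeps the denominator of [alpha] nonzero, hence [alpha] itself. *)
Lemma subr_cos_neq0 (R : realType) (x : R) : sin x != 0 -> 2 - 2 * cos x != 0.
Proof.
apply: contraNneq => h; have c1 : cos x = 1 by lra.
by rewrite -sqrf_eq0 sin2cos2 c1 expr1n subrr.
Qed.

Lemma time_harmonic0 (R : realType) (N : nat) (omega dt : R) (V : 'cV[R[i]]_N) :
  time_harmonic omega dt V 0 = V.
Proof.
by rewrite /time_harmonic expC_imag mulr0 mul0r cos0 sin0 scale1r.
Qed.

(** By the addition formulas, the [sin (omega * dt)] terms of the two neighbours cancel in their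
    sum; in the first difference the cosine terms cancel instead. *)
Lemma time_harmonic_diff2 (R : realType) (N : nat) (omega dt : R)
    (V : 'cV[R[i]]_N) (n : int) :
  time_harmonic omega dt V (n + 1) - 2 *: time_harmonic omega dt V n
    + time_harmonic omega dt V (n - 1)
  = (2 * cos (omega * dt) - 2)%:C *: time_harmonic omega dt V n.
Proof.
rewrite /time_harmonic !expC_imag intrD intrB.
have -> : omega * (n%:~R + 1%:~R) * dt = omega * n%:~R * dt + omega * dt by ring.
have -> : omega * (n%:~R - 1%:~R) * dt = omega * n%:~R * dt - omega * dt by ring.
rewrite cosD sinD cosB sinB !scalerA -scalerBl -scalerDl; congr (_ *: V).
by apply/eqP; rewrite eq_complex /=; apply/andP; split; apply/eqP; ring.
Qed.

Lemma time_harmonic_diff1 (R : realType) (N : nat) (omega dt : R)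
    (V : 'cV[R[i]]_N) (n : int) :
  time_harmonic omega dt V (n + 1) - time_harmonic omega dt V (n - 1)
  = (0 +i* (2 * sin (omega * dt))) *: time_harmonic omega dt V n.
Proof.
rewrite /time_harmonic !expC_imag intrD intrB.
have -> : omega * (n%:~R + 1%:~R) * dt = omega * n%:~R * dt + omega * dt by ring.
have -> : omega * (n%:~R - 1%:~R) * dt = omega * n%:~R * dt - omega * dt by ring.
rewrite cosD sinD cosB sinB !scalerA -scalerBl; congr (_ *: V).
by apply/eqP; rewrite eq_complex /=; apply/andP; split; apply/eqP; ring.
Qed.

Theorem proposition1 (R : realType) (N : nat) (A B : 'M[R[i]]_N)
    (omega dt : R) (U F : 'cV[R[i]]_N) :
  0 < omega -> 0 < dt -> sin (omega * dt) != 0 ->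
  let alpha : R := (omega * dt) ^+ 2 / (2 - 2 * cos (omega * dt)) in
  let beta : R := omega * dt / sin (omega * dt) in
  let u : int -> 'cV[R[i]]_N := time_harmonic omega dt U in
  let f : int -> 'cV[R[i]]_N := time_harmonic omega dt F in
  let At : 'M[R[i]]_N := alpha%:C^-1 *: A in
  let Bt : 'M[R[i]]_N := (alpha%:C^-1 * beta%:C) *: B in
  alpha = (omega * dt) ^+ 2 / (4 * sin (omega * dt / 2) ^+ 2) /\
  ((- (omega%:C ^+ 2) *: 1%:M + (0 +i* omega) *: B + A) *m U = F <->
   forall n : int,
     (1 / dt%:C ^+ 2) *: (u (n + 1) - 2 *: u n + u (n - 1))
     + (1 / (2 * dt%:C)) *: (Bt *m (u (n + 1) - u (n - 1)))
     + At *m u n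
     = alpha%:C^-1 *: f n).
Proof.
move=> omega_gt0 dt_gt0 sin_neq0 alpha beta u f At Bt.
split; first by rewrite /alpha cos_half_angle.
have omega_neq0 : omega != 0 by rewrite gt_eqF.
have dt_neq0 : dt != 0 by rewrite gt_eqF.
have cos_neq := subr_cos_neq0 _ _ sin_neq0.
have alpha_neq0 : alpha != 0.
  by rewrite mulf_neq0 ?invr_eq0 // expf_neq0 // mulf_neq0.
have alphaC_neq0 : alpha%:C != 0 :> R[i] by rewrite (fmorph_eq0 (real_complex R)).
have dtC_neq0 : dt%:C != 0 :> R[i] by rewrite (fmorph_eq0 (real_complex R)).
set K := (X in X *m U).
have diff2E : 1 / dt%:C ^+ 2 * (2 * cos (omega * dt) - 2)%:C
    = alpha%:C^-1 * - omega%:C ^+ 2.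
  (* Both sides are embedded reals, so the identity is checked in [R], where [alpha] can be
     unfolded. *)
  rewrite div1r -!rmorphXn -!fmorphV -rmorphN -!rmorphM /=; congr (_%:C).
  by rewrite /alpha; field; rewrite ?cos_neq ?omega_neq0 ?dt_neq0.
have diff1E : 1 / (2 * dt%:C) * (alpha%:C^-1 * beta%:C)
      * (0 +i* (2 * sin (omega * dt)))
    = alpha%:C^-1 * (0 +i* omega).
  have imagE (x : R) : 0 +i* x = 'i%C * x%:C.
    by apply/eqP; rewrite eq_complex /=; apply/andP; split; apply/eqP; ring.
  have betaE : beta%:C * (sin (omega * dt))%:C = omega%:C * dt%:C.
    by rewrite -!rmorphM /= /beta divfK.
  have -> : 0 +i* (2 * sin (omega * dt)) = 2 * ('i%C * (sin (omega * dt))%:C).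
    by rewrite imagE rmorphM (rmorph_nat (real_complex R)); ring.
  rewrite imagE.
  (* The product of [beta] and the sine is isolated so that [betaE] removes the sine without
     dividing by it in [R[i]]. *)
  transitivity (alpha%:C^-1 * 'i%C * (beta%:C * (sin (omega * dt))%:C) / dt%:C).
    by field; rewrite dtC_neq0 alphaC_neq0.
  by rewrite betaE; field; rewrite dtC_neq0 alphaC_neq0.
have schemeE n : (1 / dt%:C ^+ 2) *: (u (n + 1) - 2 *: u n + u (n - 1))
     + (1 / (2 * dt%:C)) *: (Bt *m (u (n + 1) - u (n - 1))) + At *m u n
   = alpha%:C^-1 *: time_harmonic omega dt (K *m U) n.
  (* The phase is a scalar, so it commutes with [K]. *)
  have -> : time_harmonic omega dt (K *m U) n = K *m u n by exact: scalemxAr.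
  rewrite time_harmonic_diff2 time_harmonic_diff1 -/(u n) /At /Bt /K.
  move: (u n) => v.
  rewrite -!scalemxAl -!scalemxAr !scalerA diff2E diff1E -!scalerA -!scalerDr.
  by rewrite !mulmxDl -!scalemxAl mul1mx.
split=> [KU n | eq_n]; first by rewrite schemeE KU.
(* At [n = 0] the phase is 1, so cancelling the inverse of [alpha] leaves the Helmholtz equation. *)
have := eq_n 0; rewrite schemeE => /(scalerI (invr_neq0 alphaC_neq0)).
by rewrite /f !time_harmonic0.
Qed.
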